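(* Assume $x(0)=x'(0)=0$ and additionally $p'(t)\to0$ as $t\to\infty$. Suppose $y_2(t)=o(1/A(t))$ and that there are constants $c_1,c_2$ with \[ x(t)=\frac{c_1\cos(\omega t)+c_2\sin(\omega t)}{A(t)}+o\Big(\frac1{A(t)}\Big)\quad(t\to\infty). \] Then the limits $\lim_{T\to\infty}\int_0^TA(t)\sin(\omega t)y_2(t)\,dt$ and $\lim_{T\to\infty}\int_0^TA(t)\cos(\omega t)y_2(t)\,dt$ exist and are finite.
   Context: Standing assumptions: $\omega>0$ is a constant; $p\in C^1([0,\infty))$ with $p(t)>0$ and $p'(t)<0$ for all $t\ge0$, $\int_0^\infty p(t)\,dt=\infty$ and $\int_0^\infty p(t)^2\,dt<\infty$; $f\in L^1_{\mathrm{loc}}([0,\infty))$. $x$ denotes the solution of $x''(t)+p(t)x'(t)+\omega^2x(t)=f(t)$, $t\ge0$. Notation: $A(t)=\exp(\frac12\int_0^tp(s)\,ds)$; $y_1(t)=\int_0^te^{-\omega^2(t-s)}f(s)\,ds$; $y_2(t)=\int_0^te^{-\omega^2(t-s)}y_1(s)\,ds=\int_0^t(t-s)e^{-\omega^2(t-s)}f(s)\,ds$. *)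

(* Defs.v *)
From HB Require Import structures.
From mathcomp Require Import all_boot all_order all_algebra.
From mathcomp Require Import all_classical all_reals all_analysis.
Set Implicit Arguments. Unset Strict Implicit. Unset Printing Implicit Defensive.
Import Order.TTheory GRing.Theory Num.Theory.
Import numFieldNormedType.Exports.
Local Open Scope classical_set_scope.
Local Open Scope ring_scope.

Section Defs.
Variable R : realType.
Local Notation mu := (@lebesgue_measure R).

Definition Afun (p : R -> R) (t : R) : R :=
  expR (2^-1 * Rintegral mu `[0, t] p).

Definition y1fun (w : R) (f : R -> R) (t : R) : R :=
  Rintegral mu `[0, t] (fun s => expR (- (w ^+ 2) * (t - s)) * f s).

Definition y2fun (w : R) (f : R -> R) (t : R) : R :=
  Rintegral mu `[0, t] (fun s => expR (- (w ^+ 2) * (t - s)) * y1fun w f s).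

Definition L1loc (f : R -> R) : Prop :=
  forall T : R, 0 <= T -> mu.-integrable `[0, T] (EFin \o f).

(* x is a (Caratheodory) solution on [0,oo) of
   x'' + p x' + w^2 x = f with x(0) = x'(0) = 0, where v plays the role of x':
   x(t) = int_0^t v,  v(t) = int_0^t (f - p v - w^2 x)  for t >= 0. *)
Definition is_solution0 (w : R) (p f x v : R -> R) : Prop :=
  (forall T : R, 0 <= T ->
     mu.-integrable `[0, T] (fun s => (f s - p s * v s - w ^+ 2 * x s)%:E)) /\
  (forall t : R, 0 <= t ->
     x t = Rintegral mu `[0, t] v /\
     v t = Rintegral mu `[0, t] (fun s => f s - p s * v s - w ^+ 2 * x s)).

(* f = o(g) as t -> +oo: verbatim the library's (section-local) littleo_def
   from landau.v, specialised to the filter +oo on R. *)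
Definition littleo_pinfty (f g : R -> R) : Prop :=
  forall eps : R, 0 < eps -> \forall t \near +oo, `|f t| <= eps * `|g t|.

End Defs.

(* Main.v *)
Require Import Defs.
From HB Require Import structures.
From mathcomp Require Import all_boot all_order all_algebra.
From mathcomp Require Import all_classical all_reals all_analysis.
From mathcomp Require Import measurable_realfun ring lra.
Import Order.TTheory GRing.Theory Num.Theory.
Import numFieldNormedType.Exports.
Local Open Scope classical_set_scope.
Local Open Scope ring_scope.

(** The functions [y1] and [y2] satisfy [y1' = f - w^2 y1] and [y2' = y1 - w^2 y2], so
    subtracting [y2] from [x] removes the merely integrable [f] from the equation. Write
    [Y = A y2] and [Z = A (x - y2)]. The Liouville transformation gives a function
    [V = Z' - (2 w^2 - p) Y] with
    [V' = - (w^2 - p'/2 - p^2/4) Z + (w^4 - w^2 + p' - p w^2 + p^2/2) Y].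
    The hypotheses say [Y -> 0] and [Z = c1 cos wt + c2 sin wt + o(1)]; the mean value
    theorem and [p' -> 0] then give the matching asymptotics of [V], whence
    [P = w Z cos wt - V sin wt] and [S = w Z sin wt + V cos wt] converge.
    Up to [O(|p'| + p^2)], which is integrable,
    [P' = (m cos wt - n sin wt) Y] and [S' = (m sin wt + n cos wt) Y]
    with [m = w (2 w^2 - p)] and [n = w^4 - w^2 - p w^2]. Since [m^2 + n^2] has a positive
    limit, this system can be solved for [Y cos wt] and [Y sin wt], and an integration by
    parts against the coefficients, whose derivatives are [O(|p'|)], gives the claim. *)

Set Implicit Arguments.
Unset Strict Implicit.
Unset Printing Implicit Defensive.

(** * Derivatives of pointwise expressions *)

Section PointwiseDerivatives.
Context {R : realType}.
Implicit Types (f g : R -> R) (t a b : R).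

(** Stating the rules for explicit pointwise functions lets the derivative of a formula be assembled
    as one term, whose value is then matched by [ring] or [field]. *)
Lemma derive_add f g t a b : is_derive t 1 f a -> is_derive t 1 g b ->
  is_derive t 1 (fun s => f s + g s) (a + b).
Proof. by move=> fa gb; exact: is_deriveD. Qed.

Lemma derive_opp f t a : is_derive t 1 f a -> is_derive t 1 (fun s => - f s) (- a).
Proof. by move=> fa; exact: is_deriveN. Qed.

Lemma derive_mul f g t a b : is_derive t 1 f a -> is_derive t 1 g b ->
  is_derive t 1 (fun s => f s * g s) (a * g t + f t * b).
Proof.
move=> fa gb; have H := is_deriveM fa gb.
apply: (is_derive_eq H).
by rewrite /GRing.scale /= addrC [a * _]mulrC.
Qed.

Lemma derive_const t a : is_derive t 1 (fun=> a) 0.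
Proof. exact: is_derive_cst. Qed.

Lemma derive_comp f g t a b : is_derive (g t) 1 f a -> is_derive t 1 g b ->
  is_derive t 1 (fun s => f (g s)) (a * b).
Proof. by move=> fa gb; exact: is_derive1_comp. Qed.

Lemma derive_scale t a : is_derive t 1 (fun s => a * s) a.
Proof.
apply: (is_derive_eq (derive_mul (derive_const t a) (is_derive_id t 1))).
by rewrite mul0r add0r mulr1.
Qed.

Lemma derive_cosM w t : is_derive t 1 (fun s => cos (w * s)) (- w * sin (w * t)).
Proof.
apply: (is_derive_eq (derive_comp (is_derive_cos (w * t)) (derive_scale t w))).
by rewrite mulrC mulrN mulNr.
Qed.

Lemma derive_sinM w t : is_derive t 1 (fun s => sin (w * s)) (w * cos (w * t)).
Proof.
apply: (is_derive_eq (derive_comp (is_derive_sin (w * t)) (derive_scale t w))).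
by rewrite mulrC.
Qed.

Lemma derive_expRM w t : is_derive t 1 (fun s => expR (w * s)) (w * expR (w * t)).
Proof.
apply: (is_derive_eq (derive_comp (is_derive_expR (w * t)) (derive_scale t w))).
by rewrite mulrC.
Qed.

Lemma derive_inv f t a : f t != 0 -> is_derive t 1 f a ->
  is_derive t 1 (fun s => (f s)^-1) (- a / f t ^+ 2).
Proof.
move=> ft0 fa; have fd : derivable f t 1 by case: fa.
apply: DeriveDef; first exact: derivableV.
by rewrite deriveV// (@derive_val _ _ _ _ _ f) /GRing.scale /= mulNr mulrC mulNr.
Qed.

Lemma derive_div f g t a b : g t != 0 ->
  is_derive t 1 f a -> is_derive t 1 g b ->
  is_derive t 1 (fun s => f s / g s) ((a * g t - f t * b) / g t ^+ 2).
Proof.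
move=> gt0 fa gb; apply: (is_derive_eq (derive_mul fa (derive_inv gt0 gb))).
by field.
Qed.

Lemma is_derive_continuous {f t a} : is_derive t 1 f a -> {for t, continuous f}.
Proof. by case=> fd _; apply/differentiable_continuous/derivable1_diffP. Qed.

End PointwiseDerivatives.

(** * Continuity and primitives on the half-line *)

Section HalfLine.
Context {R : realType}.
Local Notation mu := (@lebesgue_measure R).
Implicit Types (f g : R -> R) (s t T : R).

(** The data are constrained only at nonnegative times, so continuity is relative to the half-line:
    one-sided at 0, ordinary at every positive time. *)
Definition continuous_ge0 g := {within `[0, +oo[, continuous g}.

Lemma continuous_ge0_at g t : continuous_ge0 g -> 0 < t -> {for t, continuous g}.
Proof.
move=> /continuous_within_itvcyP[cg _] t0; apply: cg.
by rewrite in_itv/= t0.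
Qed.

Lemma continuous_ge0_segment g T : continuous_ge0 g -> {within `[0, T], continuous g}.
Proof.
apply: continuous_subspaceW => z /=; rewrite !in_itv/= => /andP[-> _]//.
Qed.

Lemma continuous_ge0_add f g : continuous_ge0 f -> continuous_ge0 g ->
  continuous_ge0 (fun t => f t + g t).
Proof. by move=> cf cg z; apply: cvgD; [exact: cf|exact: cg]. Qed.

Lemma continuous_ge0_mul f g : continuous_ge0 f -> continuous_ge0 g ->
  continuous_ge0 (fun t => f t * g t).
Proof. by move=> cf cg z; apply: cvgM; [exact: cf|exact: cg]. Qed.

Lemma continuous_ge0_everywhere f : continuous f -> continuous_ge0 f.
Proof. exact: continuous_subspaceT. Qed.

Lemma continuous_ge0_cst (k : R) : continuous_ge0 (fun=> k).
Proof. by apply: continuous_ge0_everywhere => z; exact: cvg_cst. Qed.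

Lemma continuous_ge0_comp f g : continuous f -> continuous_ge0 g ->
  continuous_ge0 (fun t => f (g t)).
Proof. by move=> cf cg z; apply: continuous_comp; [exact: cg|exact: cf]. Qed.

Lemma continuous_ge0_eq f g : (forall t, 0 <= t -> f t = g t) ->
  continuous_ge0 f -> continuous_ge0 g.
Proof.
move=> fg; rewrite /continuous_ge0; apply: subspace_eq_continuous => z.
by rewrite inE/= in_itv/= andbT => /fg.
Qed.

Lemma continuous_ge0_integrable g T : continuous_ge0 g ->
  mu.-integrable `[0, T] (EFin \o g).
Proof.
move=> cg; apply: continuous_compact_integrable; first exact: segment_compact.
exact: continuous_ge0_segment.
Qed.

Lemma continuous_ge0_L1loc g : continuous_ge0 g -> L1loc g.
Proof. by move=> cg T _; exact: continuous_ge0_integrable. Qed.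

(** On each segment the continuous factor is bounded by compactness. *)
Lemma L1loc_mul f g : continuous_ge0 g -> L1loc f -> L1loc (fun t => g t * f t).
Proof.
move=> cg fi T T0.
have cgT := @continuous_ge0_segment g T cg.
have /= := @integrableMr _ _ _ mu `[0, T] (measurable_itv _) g (EFin \o f).
apply.
- by have /integrableP[/measurable_EFinP] := @continuous_ge0_integrable g T cg.
- have /compact_bounded[M [_ mrt]] := continuous_compact cgT (@segment_compact R 0 T).
  by exists M; split; rewrite ?num_real // => ? ? ? ?; exact: mrt.
- exact: fi.
Qed.

Lemma L1loc_norm f : L1loc f -> L1loc (fun t => `|f t|).
Proof. by move=> fi T T0; exact: integrable_norm (fi _ T0). Qed.

Lemma continuous_ge0_primitive f : L1loc f ->
  continuous_ge0 (fun t => Rintegral mu `[0, t] f).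
Proof.
move=> fi; apply/continuous_within_itvcyP; split.
  move=> z; rewrite in_itv/= andbT => z0.
  (* The right end [z + 1] makes [z] interior to a segment on which continuity of the primitive is
     known. *)
  have z1 : 0 < z + 1 by rewrite addr_gt0.
  have := parameterized_integral_continuous (ltW z1) (fi _ (ltW z1)).
  move=> /(continuous_within_itvP _ z1)[+ _ _]; apply.
  by rewrite in_itv/= z0 ltrDl ltr01.
have := parameterized_integral_continuous ler01 (fi _ ler01).
by move=> /(continuous_within_itvP _ ltr01)[].
Qed.

Lemma derive_primitive g t : continuous_ge0 g -> 0 < t ->
  is_derive t 1 (fun t => Rintegral mu `[0, t] g) (g t).
Proof.
move=> cg t0; have t1 : t < t + 1 by rewrite ltrDl.
have [d e] := continuous_FTC1_closed t1 (@continuous_ge0_integrable g _ cg) t0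
  (continuous_ge0_at cg t0).
by apply: DeriveDef => //; rewrite -derive1E.
Qed.

Lemma Rintegral_segment_sub f s t : L1loc f -> 0 <= s -> s <= t ->
  Rintegral mu `[0, t] f - Rintegral mu `[0, s] f = Rintegral mu `]s, t] f.
Proof.
move=> fi s0 st; have t0 := le_trans s0 st.
by apply: Rintegral_itvB; rewrite ?bnd_simp//; exact: fi.
Qed.

Lemma L1loc_integrable_oc f s t : L1loc f -> 0 <= s -> s <= t ->
  mu.-integrable `]s, t] (EFin \o f).
Proof.
move=> fi s0 st; apply: integrableS (fi t (le_trans s0 st)) => //.
by apply: subset_itvr; rewrite bnd_simp.
Qed.

(** The difference quotient of [g] is squeezed by that of [phi], which converges to [|d|], times a
    factor tending to 0. *)
Lemma derive_eq0_of_dominated g phi eps (t d : R) : is_derive t 1 phi d ->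
  eps x @[x --> t] --> (0:R) ->
  (\forall s \near t, `|g s - g t| <= `|phi s - phi t| * eps s) ->
  is_derive t 1 g 0.
Proof.
move=> phid eps0 gphi.
have sh : (h *: 1 + t) @[h --> (0:R)^'] --> t.
    have : (h * 1 + t) @[h --> (0:R)] --> (0 * 1 + t).
      by apply: cvgD; [apply: cvgM; [exact: cvg_id|exact: cvg_cst]|exact: cvg_cst].
    rewrite mul0r add0r => H; apply: cvg_trans H.
    by apply: cvg_app; exact: cvg_within.
have q : h^-1 *: ((g \o shift t) (h *: 1) - g t) @[h --> (0:R)^'] --> (0:R).
  have phiq : `|h^-1 *: ((phi \o shift t) (h *: 1) - phi t)| * eps (h *: 1 + t)
     @[h --> (0:R)^'] --> `|d| * (0:R).
    apply: cvgM.
      by apply: cvg_norm; case: phid => /cvg_ex[l Hl] <-; rewrite /derive (cvg_lim _ Hl).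
    exact: (cvg_comp _ _ sh eps0).
  rewrite mulr0 in phiq.
  apply/norm_cvg0P; apply: squeeze_cvgr (cvg_cst 0) phiq.
  have : \forall h \near (0:R)^', `|g (h *: 1 + t) - g t| <=
      `|phi (h *: 1 + t) - phi t| * eps (h *: 1 + t) := sh _ gphi.
  apply: filterS => h /= hh.
  rewrite normr_ge0 /= !normrZ -mulrA ler_wpM2l//.
apply: DeriveDef; first by apply/cvg_ex; exists 0.
by rewrite /derive; apply: cvg_lim.
Qed.

End HalfLine.

(** * Exponential convolutions *)

Section Convolution.
Context {R : realType}.
Local Notation mu := (@lebesgue_measure R).
Local Notation prim f := (fun t : R => Rintegral mu `[0, t] f).
Implicit Types (f g phi : R -> R) (s t T a b w : R).

(** Freezing the weight at a constant [c] costs at most the oscillation [K] times the integral of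
    [|f|]; no regularity of [f] beyond integrability enters. *)
Lemma primitive_weighted_increment phi f a b c K : 0 <= a -> a <= b ->
  continuous_ge0 phi -> L1loc f ->
  (forall r, a <= r <= b -> `|phi r - c| <= K) ->
  `|(prim (fun r => phi r * f r) b - prim (fun r => phi r * f r) a)
     - c * (prim f b - prim f a)|
  <= K * (prim (fun r => `|f r|) b - prim (fun r => `|f r|) a).
Proof.
move=> a0 ab cphi fi phiK.
have pfi := L1loc_mul cphi fi.
have ni := L1loc_norm fi.
have ipf := L1loc_integrable_oc pfi a0 ab.
have iff := L1loc_integrable_oc fi a0 ab.
have inn := L1loc_integrable_oc ni a0 ab.
have icf : mu.-integrable `]a, b] (EFin \o (fun r => c * f r)).
  exact: (integrableZl _ c iff).
have iKn : mu.-integrable `]a, b] (EFin \o (fun r => K * `|f r|)).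
  exact: (integrableZl _ K inn).
have idf : mu.-integrable `]a, b] (EFin \o (fun r => phi r * f r - c * f r)).
  exact: (integrableB _ ipf icf).
rewrite (Rintegral_segment_sub pfi a0 ab) (Rintegral_segment_sub fi a0 ab).
rewrite (Rintegral_segment_sub ni a0 ab) -(RintegralZl c _ iff)//.
rewrite -(RintegralZl K _ inn)// -(RintegralB _ ipf icf)//.
apply: (le_trans (le_normr_Rintegral _ idf)) => //.
apply: le_Rintegral => //; first exact: integrable_norm idf.
move=> r /=; rewrite in_itv/= => /andP[ar rb].
by rewrite -mulrBl normrM ler_wpM2r// phiK// (ltW ar) rb.
Qed.

(** Integration by parts identifies the function with minus the integral of [phi'] against the
    primitive of [f]. For integrable [f] neither term need be differentiable at a given [t], but the
    nonsmooth parts cancel. *)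
Lemma derive_weighted_primitive phi f t d : {homo phi : x y / x <= y} ->
  continuous_ge0 phi -> L1loc f -> 0 < t -> is_derive t 1 phi d ->
  is_derive t 1 (fun s => prim (fun r => phi r * f r) s - phi s * prim f s)
    (- d * prim f t).
Proof.
move=> phi_mono cphi fi t0 phid.
pose H := fun s => prim (fun r => phi r * f r) s - phi s * prim f s.
pose N := prim (fun r => `|f r|).
(* The increment of [g] from [t] to [s] is the integral of [(phi r - phi s) * f r]. Monotonicity of
   [phi] bounds it by [|phi s - phi t| * |N s - N t|], and [N] is continuous. *)
pose g := fun s => H s + phi s * prim f t.
suff g0 : is_derive t 1 g 0.
  have := derive_add g0 (derive_opp (derive_mul phid (derive_const t (prim f t)))).
  rewrite mulr0 addr0 add0r -mulNr; congr (is_derive _ _ _ _).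
  by apply/funext => s; rewrite /g addrK.
have cN : {for t, continuous N}.
  exact: (continuous_ge0_at (continuous_ge0_primitive (L1loc_norm fi))).
apply: (@derive_eq0_of_dominated _ g phi (fun s => `|N s - N t|) _ _ phid).
  apply/norm_cvg0P; have : N s - N t @[s --> t] --> N t - N t.
    by apply: cvgB; [exact: cN|exact: cvg_cst].
  by rewrite subrr.
near=> s.
have s0 : 0 < s by near: s; exact: lt_nbhsr.
have [st|/ltW ts] := leP s t.
  have Ks r : s <= r <= t -> `|phi r - phi s| <= phi t - phi s.
    move=> /andP[sr rt]; rewrite ger0_norm ?subr_ge0; last exact: phi_mono.
    by rewrite lerD2r; exact: phi_mono.
  have := primitive_weighted_increment (ltW s0) st cphi fi Ks.
  rewrite distrC (distrC (phi s)) (distrC (N s)).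
  rewrite (ger0_norm (_ : 0 <= phi t - phi s)) ?subr_ge0; last exact: phi_mono.
  move=> h; apply: le_trans (le_trans h _).
    rewrite le_eqVlt; apply/orP; left; apply/eqP; congr (`|_|); rewrite /g /H; ring.
  by rewrite ler_wpM2l ?subr_ge0 ?ler_norm//; exact: phi_mono.
have Ks r : t <= r <= s -> `|phi r - phi s| <= phi s - phi t.
  move=> /andP[tr rs]; rewrite distrC ger0_norm ?subr_ge0; last exact: phi_mono.
  by rewrite lerD2l lerN2; exact: phi_mono.
have := primitive_weighted_increment (ltW t0) ts cphi fi Ks.
rewrite (ger0_norm (_ : 0 <= phi s - phi t)) ?subr_ge0; last exact: phi_mono.
move=> h; apply: le_trans (le_trans h _).
  rewrite le_eqVlt; apply/orP; left; apply/eqP; congr (`|_|); rewrite /g /H; ring.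
by rewrite ler_wpM2l ?subr_ge0 ?ler_norm//; exact: phi_mono.
Unshelve. all: by end_near. Qed.

Lemma y1funE w f t : L1loc f -> 0 <= t ->
  y1fun w f t = expR (- (w ^+ 2) * t) * prim (fun s => expR (w ^+ 2 * s) * f s) t.
Proof.
move=> fi t0; rewrite -RintegralZl//; last first.
  apply: L1loc_mul fi _ t0; apply: continuous_ge0_everywhere => z.
  exact: is_derive_continuous (derive_expRM _ _).
by apply: eq_Rintegral => s _; rewrite mulrA -expRD; congr (expR _ * _); ring.
Qed.

Lemma continuous_ge0_expRM w : continuous_ge0 (fun s : R => expR (w * s)).
Proof.
apply: continuous_ge0_everywhere => z.
exact: is_derive_continuous (derive_expRM _ _).
Qed.

Lemma continuous_ge0_y1 w f : L1loc f -> continuous_ge0 (y1fun w f).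
Proof.
move=> fi; apply: (@continuous_ge0_eq _ (fun t => expR (- (w ^+ 2) * t) *
   prim (fun s => expR (w ^+ 2 * s) * f s) t)).
  by move=> t t0; rewrite y1funE.
apply: continuous_ge0_mul; first exact: continuous_ge0_expRM.
by apply/continuous_ge0_primitive/L1loc_mul => //; exact: continuous_ge0_expRM.
Qed.

Lemma y2fun_y1fun w f : y2fun w f = y1fun w (y1fun w f).
Proof. by []. Qed.

(** Identities known only for nonnegative times hold near any positive time, which suffices to
    transfer a derivative. *)
Lemma near_gt0_eq f g t : 0 < t -> (forall s, 0 <= s -> f s = g s) ->
  \forall s \near t, f s = g s.
Proof.
move=> t0 fg; near=> s; apply/fg/ltW.
by near: s; exact: lt_nbhsr.
Unshelve. all: by end_near. Qed.

Lemma derive_y1_continuous w g t : continuous_ge0 g -> 0 < t ->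
  is_derive t 1 (y1fun w g) (g t - w ^+ 2 * y1fun w g t).
Proof.
move=> cg t0.
have ce := continuous_ge0_mul (@continuous_ge0_expRM (w ^+ 2)) cg.
have := derive_mul (derive_expRM (- (w ^+ 2)) t) (derive_primitive ce t0).
move/(near_eq_is_derive (near_gt0_eq t0 _)) => /(_ (y1fun w g)) H.
apply: (is_derive_eq (H _)).
  by move=> s s0; rewrite y1funE//; exact: continuous_ge0_L1loc.
rewrite y1funE ?ltW//; last exact: continuous_ge0_L1loc.
have E : expR (- w ^+ 2 * t) * expR (w ^+ 2 * t) = 1.
  by rewrite -expRD mulNr addNr expR0.
by rewrite -[X in _ = X - _]mul1r -E; ring.
Qed.

(* [y1 - \int f] equals [e^{-w^2 t} (\int e^{w^2 s} f - e^{w^2 t} \int f)]. *)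
Lemma derive_y1_sub_primitive w f t : L1loc f -> 0 < t ->
  is_derive t 1 (fun t => y1fun w f t - prim f t) (- (w ^+ 2) * y1fun w f t).
Proof.
move=> fi t0; have ce := @continuous_ge0_expRM (w ^+ 2).
have mono : {homo (fun s : R => expR (w ^+ 2 * s)) : x y / x <= y}.
  by move=> x y xy; rewrite ler_expR ler_wpM2l// sqr_ge0.
have := derive_mul (derive_expRM (- (w ^+ 2)) t)
  (derive_weighted_primitive mono ce fi t0 (derive_expRM (w ^+ 2) t)).
have E s : expR (- w ^+ 2 * s) * expR (w ^+ 2 * s) = 1.
  by rewrite -expRD mulNr addNr expR0.
move/(near_eq_is_derive (near_gt0_eq t0 _)).
move=> /(_ (fun t => y1fun w f t - prim f t)) H.
apply: (is_derive_eq (H _)).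
  move=> s s0; rewrite y1funE//.
  by rewrite -[prim f s in RHS]mul1r -(E s); ring.
rewrite y1funE ?ltW//.
have := E t; set e := expR _; set e' := expR _ => ee'.
transitivity (- w ^+ 2 * e * prim (fun s => expR (w ^+ 2 * s) * f s) t
  + (w ^+ 2 * prim f t) * (e * e') - (w ^+ 2 * prim f t) * (e * e')); last by ring.
by ring.
Qed.

End Convolution.

(** * Behaviour at infinity *)

Section Asymptotics.
Context {R : realType}.
Implicit Types (f g df dg : R -> R) (t a w M l : R).

Lemma near_pinfty_gt l : \forall t \near +oo, l < t.
Proof. by apply: nbhs_pinfty_gt; rewrite num_real. Qed.

Lemma near_pinfty_ge l : \forall t \near +oo, l <= t.
Proof. by apply: nbhs_pinfty_ge; rewrite num_real. Qed.

(** The closure properties below allow boundedness of a polynomial expression to be found by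
    recursion on its syntax. *)
Definition eventually_bounded f := exists M, \forall t \near +oo, `|f t| <= M.

Lemma eventually_bounded_add f g : eventually_bounded f -> eventually_bounded g ->
  eventually_bounded (fun t => f t + g t).
Proof.
move=> [M fM] [N gN]; exists (M + N); near=> t.
by rewrite (le_trans (ler_normD _ _))// lerD//; near: t.
Unshelve. all: by end_near. Qed.

Lemma eventually_bounded_opp f : eventually_bounded f ->
  eventually_bounded (fun t => - f t).
Proof.
by move=> [M fM]; exists M; near=> t; rewrite normrN; near: t.
Unshelve. all: by end_near. Qed.

Lemma eventually_bounded_mul f g : eventually_bounded f -> eventually_bounded g ->
  eventually_bounded (fun t => f t * g t).
Proof.
move=> [M fM] [N gN]; exists (M * N); near=> t.
by rewrite normrM ler_pM//; near: t.
Unshelve. all: by end_near. Qed.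

Lemma eventually_bounded_cst l : eventually_bounded (fun=> l).
Proof. by exists `|l|; near=> t. Unshelve. all: by end_near. Qed.

Lemma eventually_bounded_cvg f l : f t @[t --> +oo] --> l -> eventually_bounded f.
Proof.
move=> fl; exists (`|l| + 1); near=> t.
rewrite -lerBlDl (le_trans (lerB_dist _ _))// distrC.
by near: t; move/cvgrPdist_le : fl; apply.
Unshelve. all: by end_near. Qed.

Lemma eventually_bounded_cos w : eventually_bounded (fun t => cos (w * t)).
Proof. by exists 1; near=> t; rewrite ler_norml cos_geN1 cos_le1. Unshelve. all: by end_near. Qed.

Lemma eventually_bounded_sin w : eventually_bounded (fun t => sin (w * t)).
Proof. by exists 1; near=> t; rewrite ler_norml sin_geN1 sin_le1. Unshelve. all: by end_near. Qed.

Lemma cvg0_mul_bounded f g : f t @[t --> +oo] --> (0:R) -> eventually_bounded g ->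
  f t * g t @[t --> +oo] --> (0:R).
Proof.
move=> f0 [M gM]; apply/norm_cvg0P.
have H : `|f t| * M @[t --> +oo] --> (0:R).
  rewrite -(mul0r M); apply: cvgM; last exact: cvg_cst.
  by rewrite -(@normr0 _ R); apply: cvg_norm.
apply: squeeze_cvgr (cvg_cst 0) H; near=> t.
rewrite normr_ge0 normrM ler_wpM2l//; near: t; exact: gM.
Unshelve. all: by end_near. Qed.

(** A single explicit threshold is what the mean value theorem needs, since it evaluates derivatives
    at unknown intermediate points. *)
Lemma near_pinftyW (P : R -> Prop) : (\forall t \near +oo, P t) ->
  exists2 T : R, 0 < T & forall t, T < t -> P t.
Proof.
move=> [T [_ HT]]; exists (Num.max 1 T); first by rewrite lt_max ltr01.
by move=> t; rewrite gt_max => /andP[_ /HT].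
Qed.

Lemma nondecreasing_derive_ge0 f df (T : R) :
  (forall t, T < t -> is_derive t 1 f (df t) /\ 0 <= df t) ->
  forall s t, T < s -> s <= t -> f s <= f t.
Proof.
move=> fd s t Ts st.
have [c /itvP cst e] : exists2 c, c \in `[s, t]%R & f t - f s = df c * (t - s).
  apply: MVT_segment => //.
    by move=> x /itvP xst; apply: (fd _ _).1; rewrite (lt_le_trans Ts)// xst.
  apply: derivable_within_continuous => x /itvP xst.
  by case: (fd x _).1 => //; rewrite (lt_le_trans Ts)// xst.
rewrite -subr_ge0 e mulr_ge0 ?subr_ge0//.
by apply: (fd _ _).2; rewrite (lt_le_trans Ts)// cst.
Qed.

Lemma cvg_nondecreasing_bounded f df M :
  (\forall t \near +oo, is_derive (t:R) 1 f (df t) /\ 0 <= df t) ->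
  (\forall t \near +oo, f t <= M) -> cvg (f t @[t --> +oo]).
Proof.
move=> fd fM; have [T T0 HT] := near_pinftyW (filterI fd fM).
have mono := nondecreasing_derive_ge0 (fun t Tt => (HT t Tt).1).
(* Freezing [f] before [T + 1] makes it monotone and bounded on the whole line, as monotone
   convergence requires, without changing it near infinity. *)
pose g t := f (Num.max t (T + 1)).
have TT1 : T < T + 1 by rewrite ltrDl.
have [l gl] : exists l, g t @[t --> +oo] --> l.
  eexists; apply: nondecreasing_cvgr.
    move=> x y xy; apply: mono; first by rewrite lt_max TT1 orbT.
    by rewrite ge_max !le_max xy lexx orbT.
  by exists M => _ [t _ <-]; apply: (HT _ _).2; rewrite lt_max TT1 orbT.
apply/cvg_ex; exists l; apply: cvg_trans gl; apply: near_eq_cvg; near=> t; by rewrite /g max_l.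
Unshelve. all: by end_near. Qed.

(** Both [g] and [g + f] are eventually nondecreasing and bounded above, so both converge, and [f]
    is their difference. *)
Lemma cvg_derive_dominated f df g dg M :
  (\forall t \near +oo, is_derive (t:R) 1 f (df t)) ->
  (\forall t \near +oo, is_derive (t:R) 1 g (dg t)) ->
  (\forall t \near +oo, `|df t| <= dg t) ->
  (\forall t \near +oo, g t <= M) -> cvg (f t @[t --> +oo]).
Proof.
move=> fd gd fg gM.
have gc : cvg (g t @[t --> +oo]).
  apply: (@cvg_nondecreasing_bounded _ dg M) => //; near=> t; split.
    by near: t.
  by apply: (le_trans (normr_ge0 (df t))); near: t.
have [T T0 HT] := near_pinftyW (filterI (filterI fd gd) fg).
(* Since [g - f] is also nondecreasing, [f] inherits an upper bound from [g]; this bounds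
   [g + f]. *)
have up : forall t, T + 1 <= t -> f t <= f (T + 1) + (g t - g (T + 1)).
  move=> t Tt.
  have H : forall t, T < t -> is_derive t 1 (fun s => g s + - f s) (dg t + - df t)
      /\ 0 <= dg t + - df t.
    move=> s /HT[[fs gs] fgs]; split; first exact: derive_add (derive_opp _).
    by rewrite subr_ge0 (le_trans (ler_norm _)).
  have TT1 : T < T + 1 by rewrite ltrDl.
  have := nondecreasing_derive_ge0 H TT1 Tt.
  lra.
have sc : cvg ((fun t => g t + f t) t @[t --> +oo]).
  apply: (@cvg_nondecreasing_bounded _ (fun t => dg t + df t)
    (M + (f (T + 1) + (M - g (T + 1))))); near=> t.
    have Tt : T < t by near: t; exact: near_pinfty_gt.
    have [[fs gs] fgs] := HT t Tt.
    split; first exact: derive_add.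
    by rewrite -(opprK (df t)) subr_ge0 (le_trans _ fgs)// -normrN ler_norm.
  have gMt : g t <= M by near: t.
  have := up t; have -> : T + 1 <= t by near: t; exact: near_pinfty_ge.
  by move=> /(_ isT); lra.
have -> : f = fun t => (g t + f t) - g t by apply/funext => t; lra.
exact: is_cvgB.
Unshelve. all: by end_near. Qed.

(* Landau's trick: by the mean value theorem [f (t+1) - f t] is close to [g c]
   for some [c], and [g c] is close to [g t]. *)
Lemma cvg0_derive_landau f g (e1 e2 : R -> R) :
  (\forall t \near +oo, is_derive (t:R) 1 f (g t + e1 t)) ->
  (\forall t \near +oo, is_derive (t:R) 1 g (e2 t)) ->
  f t @[t --> +oo] --> (0:R) -> e1 t @[t --> +oo] --> (0:R) ->
  e2 t @[t --> +oo] --> (0:R) -> g t @[t --> +oo] --> (0:R).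
Proof.
move=> fd gd f0 e10 e20; apply/cvgrPdist_le => eps eps0.
(* In the end [g t] is a sum of four terms, [f (t + 1)], [- f t], [- e1 c] and [- e2 d * (c - t)],
   each at most [eps / 4] in size; the last uses [c - t <= 1]. *)
have e4 : 0 < eps / 4 by rewrite divr_gt0.
move/cvgrPdist_le : f0 => /(_ _ e4) Hf.
move/cvgrPdist_le : e10 => /(_ _ e4) H1.
move/cvgrPdist_le : e20 => /(_ _ e4) H2.
have [T T0 HT] := near_pinftyW (filterI (filterI fd gd) (filterI Hf (filterI H1 H2))).
near=> t.
have Tt : T < t by near: t; exact: near_pinfty_gt.
have [c /itvP ct ec] : exists2 c, c \in `[t, t + 1]%R &
    f (t + 1) - f t = (g c + e1 c) * (t + 1 - t).
  apply: MVT_segment; first by rewrite lerDl.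
    by move=> x /itvP xt; apply: (HT _ _).1.1; rewrite (lt_le_trans Tt)// xt.
  apply: derivable_within_continuous => x /itvP xt.
  by case: (HT x _).1.1 => //; rewrite (lt_le_trans Tt)// xt.
have [d /itvP dt ed] : exists2 d, d \in `[t, c]%R & g c - g t = e2 d * (c - t).
  apply: MVT_segment; first by rewrite ct.
    by move=> x /itvP xt; apply: (HT _ _).1.2; rewrite (lt_le_trans Tt)// xt.
  apply: derivable_within_continuous => x /itvP xt.
  by case: (HT x _).1.2 => //; rewrite (lt_le_trans Tt)// xt.
have Tc : T < c by rewrite (lt_le_trans Tt)// ct.
have Td : T < d by rewrite (lt_le_trans Tt)// dt.
have Tt1 : T < t + 1 by rewrite (lt_le_trans Tt)// lerDl.
have [_ [+ _]] := HT _ Tt; have [_ [+ _]] := HT _ Tt1.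
have [_ [_ [+ _]]] := HT _ Tc; have [_ [_ [_ +]]] := HT _ Td.
rewrite !sub0r !normrN => e2d e1c ft1 ft.
have e2dc : `|e2 d * (c - t)| <= eps / 4.
  rewrite normrM (le_trans _ e2d)// ler_piMr// ger0_norm ?subr_ge0 ?ct//.
  by rewrite lerBlDl ct.
rewrite addrAC subrr add0r mulr1 in ec.
have -> : g t = f (t + 1) - f t - e1 c - e2 d * (c - t) by rewrite -ed ec; lra.
move: e2dc ft1 ft e1c; rewrite !ler_norml => /andP[? ?] /andP[? ?] /andP[? ?] /andP[? ?].
by apply/andP; split; lra.
Unshelve. all: by end_near. Qed.

End Asymptotics.

(** * Slowly varying amplitudes *)

Section Oscillation.
Context {R : realType}.

(* [I] differs from the convergent function [(m P + n S) / (m^2 + n^2)] by a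
   function whose derivative is [O(p' + p^2)]. *)
Lemma cvg_phase_integral (w a M lP lS : R) (p dp B P S c s Y sg I : R -> R)
    (m := fun t => w * (2 * a - p t)) (n := fun t => a ^+ 2 - a - a * p t)
    (rho := fun t => (dp t + p t ^+ 2 / 2) * sg t) :
  0 < w -> 0 < a ->
  (\forall t \near +oo, [/\ is_derive (t:R) 1 p (dp t), 0 < p t & dp t < 0]) ->
  p t @[t --> +oo] --> (0:R) ->
  (\forall t \near +oo, is_derive (t:R) 1 B (p t ^+ 2)) ->
  (\forall t \near +oo, B t <= M) ->
  (\forall t \near +oo,
    is_derive (t:R) 1 P ((m t * c t - n t * s t) * Y t - rho t * s t)) ->
  (\forall t \near +oo,
    is_derive (t:R) 1 S ((m t * s t + n t * c t) * Y t + rho t * c t)) ->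
  (\forall t \near +oo, is_derive (t:R) 1 I (Y t * c t)) ->
  eventually_bounded c -> eventually_bounded s -> eventually_bounded sg ->
  P t @[t --> +oo] --> lP -> S t @[t --> +oo] --> lS ->
  cvg (I t @[t --> +oo]).
Proof.
move=> w0 a0 ph p0 dB BM dP dS dI cb sb sgb PlP SlS.
have mc : m t @[t --> +oo] --> w * (2 * a - 0).
  by apply: cvgM; [exact: cvg_cst|apply: cvgB => //; exact: cvg_cst].
have nc : n t @[t --> +oo] --> a ^+ 2 - a - a * 0.
  apply: cvgB; [exact: cvg_cst|]; apply: cvgM => //; exact: cvg_cst.
(* [k] is the determinant of the system for [Y c] and [Y s]: the combination [m P' + n S'] equals
   [k Y c] plus a multiple of [rho]. *)
pose k t := m t ^+ 2 + n t ^+ 2.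
pose kl := (w * (2 * a - 0)) ^+ 2 + (a ^+ 2 - a - a * 0) ^+ 2.
have kc : k t @[t --> +oo] --> kl.
  by apply: cvgD; rewrite expr2; under eq_fun do rewrite expr2; exact: cvgM.
have kl0 : 0 < kl.
  rewrite /kl subr0 ltr_wpDr ?sqr_ge0// exprn_gt0// !mulr_gt0//.
have kic : (k t)^-1 @[t --> +oo] --> kl^-1 by apply: cvgV => //; rewrite gt_eqF.
pose Q t := (m t * P t + n t * S t) / k t.
have Qc : Q t @[t --> +oo] --> (w * (2 * a - 0) * lP + (a ^+ 2 - a - a * 0) * lS) / kl.
  by apply: cvgM => //; apply: cvgD; exact: cvgM.
(* [Ga] and [Gb] are the coefficients of [p'] and [p^2] in [I' - Q'], where the terms in [Y] have
   cancelled. *)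
pose Ga t := ((m t * s t - n t * c t) * sg t + (w * P t + a * S t)) * (k t)^-1
  + - (2 * ((m t * P t + n t * S t) * ((m t * w + n t * a) * ((k t)^-1 * (k t)^-1)))).
pose Gb t := 2^-1 * ((m t * s t - n t * c t) * sg t * (k t)^-1).
have mb := eventually_bounded_cvg mc.
have nb := eventually_bounded_cvg nc.
have kb := eventually_bounded_cvg kic.
have Pb := eventually_bounded_cvg PlP.
have Sb := eventually_bounded_cvg SlS.
have eC := @eventually_bounded_cst R.
have [K1 HK1] : eventually_bounded Ga.
  by repeat first [assumption | exact: eC | apply: eventually_bounded_add
    | apply: eventually_bounded_mul | apply: eventually_bounded_opp].
have [K2 HK2] : eventually_bounded Gb.
  by repeat first [assumption | exact: eC | apply: eventually_bounded_add
    | apply: eventually_bounded_mul | apply: eventually_bounded_opp].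
have thc : cvg ((fun t => I t + - Q t) t @[t --> +oo]).
  (* Since [p' < 0], the dominating derivative [K2 p^2 - K1 p'] is [K2 p^2 + K1 |p'|]. Its primitive
     [K2 B - K1 p] is at most [K2 M] because [p > 0]. *)
  apply: (@cvg_derive_dominated _ _ (fun t => dp t * Ga t + p t ^+ 2 * Gb t)
    (fun t => K2 * B t + - (K1 * p t)) (fun t => K2 * p t ^+ 2 + - (K1 * dp t))
    (K2 * M)); near=> t.
  - have [dpt pt dpt0] : [/\ is_derive (t:R) 1 p (dp t), 0 < p t & dp t < 0] by near: t.
    have k0 : k t != 0.
      rewrite gt_eqF//; near: t; exact: cvgr_gt kc _ kl0.
    have dIt : is_derive (t:R) 1 I (Y t * c t) by near: t.
    have dPt : is_derive (t:R) 1 P ((m t * c t - n t * s t) * Y t - rho t * s t) by near: t.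
    have dSt : is_derive (t:R) 1 S ((m t * s t + n t * c t) * Y t + rho t * c t) by near: t.
    have dm : is_derive (t:R) 1 m (- w * dp t).
      apply: (is_derive_eq (derive_mul (derive_const t w)
        (derive_add (derive_const t (2 * a)) (derive_opp dpt)))).
      by rewrite mul0r !add0r mulrN mulNr.
    have dn : is_derive (t:R) 1 n (- a * dp t).
      apply: (is_derive_eq (derive_add (derive_const t (a ^+ 2 - a))
        (derive_opp (derive_mul (derive_const t a) dpt)))).
      by rewrite mul0r !add0r mulNr.
    have dk := derive_add (derive_mul dm dm) (derive_mul dn dn).
    have kE : (fun s => m s * m s + n s * n s) = k by apply/funext => z; rewrite /k !expr2.
    rewrite kE in dk.
    have dQ := derive_div k0 (derive_add (derive_mul dm dPt) (derive_mul dn dSt)) dk.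
    apply: (is_derive_eq (derive_add dIt (derive_opp dQ))).
    rewrite /Ga /Gb /rho.
    have := k0; have : k t = m t ^+ 2 + n t ^+ 2 by [].
    move: (k t) (m t) (n t) => k' m' n' kE' k0'.
    (* Multiplying the leading term by [(m'^2 + n'^2) / k'], which is 1, exposes the cancellation to
       [field] while [k'] stays opaque. *)
    transitivity (Y t * c t * (m' ^+ 2 + n' ^+ 2) / k' - ((- w * dp t * P t +
       m' * ((m' * c t - n' * s t) * Y t - (dp t + p t ^+ 2 / 2) * sg t * s t) +
      (- a * dp t * S t + n' * ((m' * s t + n' * c t) * Y t + (dp t + p t ^+ 2 / 2) * sg t * c t))) *
     k' - (m' * P t + n' * S t) * (- w * dp t * m' + m' * (- w * dp t) + (- a * dp t * n' + n' * (- a * dp t)))) /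
   k' ^+ 2).
      by congr (_ + _); rewrite -kE' mulfK.
    by field.
  - have dBt : is_derive (t:R) 1 B (p t ^+ 2) by near: t.
    have [dpt _ _] : [/\ is_derive (t:R) 1 p (dp t), 0 < p t & dp t < 0] by near: t.
    apply: (is_derive_eq (derive_add (derive_mul (derive_const t K2) dBt)
      (derive_opp (derive_mul (derive_const t K1) dpt)))).
    by rewrite !mul0r !add0r.
  - have [dpt pt dpt0] : [/\ is_derive (t:R) 1 p (dp t), 0 < p t & dp t < 0] by near: t.
    rewrite (le_trans (ler_normD _ _))// (normrM (dp t)) (normrM (p t ^+ 2)) addrC lerD//.
      rewrite ger0_norm ?sqr_ge0// mulrC ler_wpM2r ?sqr_ge0//; near: t; exact: HK2.
    rewrite ltr0_norm// mulrC -mulrN ler_wpM2r ?oppr_ge0 ?(ltW dpt0)//; near: t; exact: HK1.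
  - have [dpt pt dpt0] : [/\ is_derive (t:R) 1 p (dp t), 0 < p t & dp t < 0] by near: t.
    have K10 : 0 <= K1 by apply: (le_trans (normr_ge0 (Ga t))); near: t.
    have K20 : 0 <= K2 by apply: (le_trans (normr_ge0 (Gb t))); near: t.
    have BMt : B t <= M by near: t.
    rewrite -[leRHS]addr0 lerD//; first by rewrite ler_wpM2l.
    by rewrite oppr_le0 mulr_ge0// ltW.
have -> : I = fun t => (I t + - Q t) + Q t by apply/funext => t; rewrite subrK.
by apply: is_cvgD => //; apply/cvg_ex; eexists; exact: Qc.
Unshelve. all: by end_near. Qed.

(** As [p] decreases, [p t ^+ 2 * (t - (T + 1))] is at most the increment of [B] from [T + 1] to
    [t], hence bounded. *)
Lemma cvg0_square_integrable (p dp B : R -> R) (M : R) :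
  (\forall t \near +oo, [/\ is_derive (t:R) 1 p (dp t), 0 < p t & dp t < 0]) ->
  (\forall t \near +oo, is_derive (t:R) 1 B (p t ^+ 2)) ->
  (\forall t \near +oo, B t <= M) -> p t @[t --> +oo] --> (0:R).
Proof.
move=> ph dB BM; have [T T0 HT] := near_pinftyW (filterI (filterI ph dB) BM).
have pmono s t : T < s -> s <= t -> p t <= p s.
  move=> Ts st; rewrite -lerN2.
  apply: (@nondecreasing_derive_ge0 _ (fun t => - p t) (fun t => - dp t) T) Ts st => u Tu.
  have [[[pu _ du] _] _] := HT _ Tu.
  by split; [exact: derive_opp|rewrite oppr_ge0 ltW].
pose D := M - B (T + 1).
have pD t : T + 1 < t -> p t ^+ 2 * (t - (T + 1)) <= D.
  move=> Tt; have TT1 : T < T + 1 by rewrite ltrDl.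
  have [c ct ec] : exists2 c, c \in `[T + 1, t]%R &
      B t - B (T + 1) = p c ^+ 2 * (t - (T + 1)).
    apply: MVT_segment; first exact: ltW.
      by move=> x /itvP xt; apply: (HT _ _).1.2; rewrite (lt_le_trans TT1)// xt.
    apply: derivable_within_continuous => x /itvP xt.
    by case: (HT x _).1.2 => //; rewrite (lt_le_trans TT1)// xt.
  have [_ BtM] := HT _ (lt_trans TT1 Tt).
  apply: (@le_trans _ _ (B t - B (T + 1))); last by rewrite lerD2r.
  rewrite ec; apply: ler_wpM2r; first by rewrite subr_ge0 ltW.
  rewrite ler_sqr ?nnegrE.
  - by apply: pmono; [rewrite (lt_le_trans TT1)// (itvP ct)|rewrite (itvP ct)].
  - by have [[[_ /ltW]]] := HT _ (lt_trans TT1 Tt).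
  - have Tc : T < c by rewrite (lt_le_trans TT1)// (itvP ct).
    by have [[[_ /ltW]]] := HT _ Tc.
apply/cvgrPdist_le => e e0; near=> t.
have Tt : T + 1 < t by near: t; exact: near_pinfty_gt.
have Tt' : T < t by near: t; exact: near_pinfty_gt.
(* Beyond this time [e ^+ 2 * (t - (T + 1))] exceeds [D], so [p t > e] is impossible. *)
have Dt : T + 1 + D / e ^+ 2 < t by near: t; exact: near_pinfty_gt.
have [[[_ pt _] _] _] := HT _ Tt'.
rewrite sub0r normrN gtr0_norm// leNgt; apply/negP => ept.
have := pD _ Tt; apply/negP; rewrite -ltNge.
have e2 : 0 < e ^+ 2 by rewrite exprn_gt0.
have : D < e ^+ 2 * (t - (T + 1)) by rewrite mulrC -ltr_pdivrMr// ltrBrDl.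
move=> /lt_le_trans; apply; apply: ler_wpM2r; first by rewrite subr_ge0 ltW.
by rewrite ler_sqr ?nnegrE ltW.
Unshelve. all: by end_near. Qed.

End Oscillation.

(** * The transformed system *)

Section Liouville.
Context {R : realType}.

(** Variation of constants: both combinations are constant along [Z' = V], [V' = - w^2 Z], so their
    derivatives see only the perturbation of the free oscillator. *)
Lemma derive_rotation (w t z' v' : R) (Z V : R -> R) :
  is_derive t 1 Z z' -> is_derive t 1 V v' ->
  is_derive t 1 (fun t => w * Z t * cos (w * t) - V t * sin (w * t))
    ((w * z' - w * V t) * cos (w * t) - (v' + w ^+ 2 * Z t) * sin (w * t)) /\
  is_derive t 1 (fun t => w * Z t * sin (w * t) + V t * cos (w * t))
    ((w * z' - w * V t) * sin (w * t) + (v' + w ^+ 2 * Z t) * cos (w * t)).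
Proof.
move=> dZ dV; have dwZ := derive_mul (derive_const t w) dZ.
split.
  apply: (is_derive_eq (derive_add (derive_mul dwZ (derive_cosM w t))
    (derive_opp (derive_mul dV (derive_sinM w t))))); ring.
apply: (is_derive_eq (derive_add (derive_mul dwZ (derive_sinM w t))
    (derive_mul dV (derive_cosM w t)))); ring.
Qed.

(** No integral appears here: [B], [Ic] and [Is] stand for primitives of [p^2], [Y cos wt] and
    [Y sin wt], known through their eventual derivatives. *)
Lemma cvg_oscillatory_integrals (w c1 c2 M : R)
    (p dp B Z V Y Ic Is : R -> R) (tau := fun t => c1 * cos (w * t) + c2 * sin (w * t)) :
  0 < w ->
  (\forall t \near +oo, [/\ is_derive (t:R) 1 p (dp t), 0 < p t & dp t < 0]) ->
  (\forall t \near +oo, is_derive (t:R) 1 B (p t ^+ 2)) ->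
  (\forall t \near +oo, B t <= M) ->
  dp t @[t --> +oo] --> (0:R) -> Y t @[t --> +oo] --> (0:R) ->
  Z t - tau t @[t --> +oo] --> (0:R) ->
  (\forall t \near +oo, is_derive (t:R) 1 Z (V t + (2 * w ^+ 2 - p t) * Y t)) ->
  (\forall t \near +oo, is_derive (t:R) 1 V
     (- (w ^+ 2 - dp t / 2 - p t ^+ 2 / 4) * Z t +
      (w ^+ 4 - w ^+ 2 + dp t - p t * w ^+ 2 + p t ^+ 2 / 2) * Y t)) ->
  (\forall t \near +oo, is_derive (t:R) 1 Ic (Y t * cos (w * t))) ->
  (\forall t \near +oo, is_derive (t:R) 1 Is (Y t * sin (w * t))) ->
  cvg (Ic t @[t --> +oo]) /\ cvg (Is t @[t --> +oo]).
Proof.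
move=> w0 ph dB BM dp0 Y0 Ztau dZ dV dIc dIs.
have w20 : 0 < w ^+ 2 by rewrite exprn_gt0.
have p0 := cvg0_square_integrable ph dB BM.
have eC := @eventually_bounded_cst R.
have cb := eventually_bounded_cos w; have sb := eventually_bounded_sin w.
have pb := eventually_bounded_cvg p0; have dpb := eventually_bounded_cvg dp0.
have Yb := eventually_bounded_cvg Y0.
have taub : eventually_bounded tau.
  by apply: eventually_bounded_add; exact: eventually_bounded_mul.
have Zb : eventually_bounded Z.
  have -> : Z = fun t => (Z t - tau t) + tau t by apply/funext => t; rewrite subrK.
  by apply: eventually_bounded_add => //; exact: eventually_bounded_cvg Ztau.
pose dtau t := w * (c2 * cos (w * t) - c1 * sin (w * t)).
have dtauE (t : R) : is_derive t 1 tau (dtau t).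
  apply: (is_derive_eq (derive_add (derive_mul (derive_const t c1) (derive_cosM w t))
    (derive_mul (derive_const t c2) (derive_sinM w t)))).
  by rewrite /dtau; ring.
have ddtauE (t : R) : is_derive t 1 dtau (- w ^+ 2 * tau t).
  apply: (is_derive_eq (derive_mul (derive_const t w) (derive_add
    (derive_mul (derive_const t c2) (derive_cosM w t))
    (derive_opp (derive_mul (derive_const t c1) (derive_sinM w t)))))).
  by rewrite /tau; ring.
have gY : (2 * w ^+ 2 - p t) * Y t @[t --> +oo] --> (0:R).
  under eq_fun do rewrite mulrC.
  apply: cvg0_mul_bounded => //; apply: eventually_bounded_add; first exact: eC.
  exact: eventually_bounded_opp.
(* Landau's trick for [Z - tau]: its derivative is [V - tau'] plus a null term, and [(V - tau')']
   tends to 0 because [tau'' = - w^2 tau]. *)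
have W0 : V t + - dtau t @[t --> +oo] --> (0:R).
  apply: (@cvg0_derive_landau _ (fun t => Z t + - tau t) _
    (fun t => (2 * w ^+ 2 - p t) * Y t)
    (fun t => - (w ^+ 2 - dp t / 2 - p t ^+ 2 / 4) * Z t +
      (w ^+ 4 - w ^+ 2 + dp t - p t * w ^+ 2 + p t ^+ 2 / 2) * Y t + - (- w ^+ 2 * tau t))) => //.
  - near=> t; have dZt : is_derive t 1 Z (V t + (2 * w ^+ 2 - p t) * Y t) by near: t.
    by apply: (is_derive_eq (derive_add dZt (derive_opp (dtauE t)))); ring.
  - near=> t; apply: derive_add; last exact: derive_opp (ddtauE t).
    by near: t.
  (* Each of the four summands is a null factor, [Z - tau], [p'], [p] or [Y], times a bounded
     one. *)
  have -> : (fun t => - (w ^+ 2 - dp t / 2 - p t ^+ 2 / 4) * Z t +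
      (w ^+ 4 - w ^+ 2 + dp t - p t * w ^+ 2 + p t ^+ 2 / 2) * Y t + - (- w ^+ 2 * tau t))
    = fun t => (Z t - tau t) * (- w ^+ 2) + dp t * (Z t * 2^-1) + p t * (p t * Z t * 4^-1)
       + Y t * (w ^+ 4 - w ^+ 2 + dp t + p t * (- w ^+ 2) + p t * (p t * 2^-1)).
    by apply/funext => t; field.
  have z4 : (0:R) = 0 + 0 + 0 + 0 by rewrite !addr0.
  rewrite [X in _ --> X]z4.
  repeat apply: cvgD; apply: cvg0_mul_bounded => //;
  by repeat first [assumption | exact: eC | apply: eventually_bounded_add
    | apply: eventually_bounded_mul | apply: eventually_bounded_opp].
pose P t := w * Z t * cos (w * t) - V t * sin (w * t).
pose S t := w * Z t * sin (w * t) + V t * cos (w * t).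
have Pc : P t @[t --> +oo] --> w * c1.
  (* With [tau] and [tau'] in place of [Z] and [V] the combination is exactly [w * c1]; the
     Pythagorean identity is inserted as a zero term. *)
  have -> : P = fun t => (Z t - tau t) * (w * cos (w * t)) + (V t + - dtau t) * (- sin (w * t)) + w * c1.
    apply/funext => t; rewrite /P /tau /dtau.
    transitivity (w * Z t * cos (w * t) - V t * sin (w * t) + w * c1 * (1 - (cos (w * t) ^+ 2 + sin (w * t) ^+ 2))).
      by rewrite cos2Dsin2 subrr mulr0 addr0.
    ring.
  rewrite -[X in _ --> X]add0r -[X in _ --> X + _](addr0 0).
  apply: cvgD; last exact: cvg_cst.
  by apply: cvgD; apply: cvg0_mul_bounded => //;
  repeat first [assumption | exact: eC | apply: eventually_bounded_mul | apply: eventually_bounded_opp].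
have Sc : S t @[t --> +oo] --> w * c2.
  have -> : S = fun t => (Z t - tau t) * (w * sin (w * t)) + (V t + - dtau t) * cos (w * t) + w * c2.
    apply/funext => t; rewrite /S /tau /dtau.
    transitivity (w * Z t * sin (w * t) + V t * cos (w * t) + w * c2 * (1 - (cos (w * t) ^+ 2 + sin (w * t) ^+ 2))).
      by rewrite cos2Dsin2 subrr mulr0 addr0.
    ring.
  rewrite -[X in _ --> X]add0r -[X in _ --> X + _](addr0 0).
  apply: cvgD; last exact: cvg_cst.
  by apply: cvgD; apply: cvg0_mul_bounded => //;
  repeat first [assumption | exact: eC | apply: eventually_bounded_mul | apply: eventually_bounded_opp].
(* In [V' + w^2 Z] the terms in [p'] and [p^2] combine to [(p' + p^2 / 2) (Y + Z / 2)]. *)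
pose sg t := Y t + Z t * 2^-1.
have sgb : eventually_bounded sg.
  by apply: eventually_bounded_add => //; exact: eventually_bounded_mul.
split.
- apply: (@cvg_phase_integral _ w (w ^+ 2) M _ _ p dp B P S
    (fun t => cos (w * t)) (fun t => sin (w * t)) Y sg) Pc Sc => //.
  + near=> t; have dZt : is_derive t 1 Z (V t + (2 * w ^+ 2 - p t) * Y t) by near: t.
    have dVt : is_derive t 1 V (- (w ^+ 2 - dp t / 2 - p t ^+ 2 / 4) * Z t +
      (w ^+ 4 - w ^+ 2 + dp t - p t * w ^+ 2 + p t ^+ 2 / 2) * Y t) by near: t.
    by apply: (is_derive_eq (derive_rotation w dZt dVt).1); rewrite /sg; field.
  + near=> t; have dZt : is_derive t 1 Z (V t + (2 * w ^+ 2 - p t) * Y t) by near: t.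
    have dVt : is_derive t 1 V (- (w ^+ 2 - dp t / 2 - p t ^+ 2 / 4) * Z t +
      (w ^+ 4 - w ^+ 2 + dp t - p t * w ^+ 2 + p t ^+ 2 / 2) * Y t) by near: t.
    by apply: (is_derive_eq (derive_rotation w dZt dVt).2); rewrite /sg; field.
(* The sine integral is the cosine one for the pair rotated by a quarter turn. *)
have PNc : - P t @[t --> +oo] --> - (w * c1) by exact: cvgN.
apply: (@cvg_phase_integral _ w (w ^+ 2) M _ _ p dp B S (fun t => - P t)
    (fun t => sin (w * t)) (fun t => - cos (w * t)) Y sg) Sc PNc => //.
- near=> t; have dZt : is_derive t 1 Z (V t + (2 * w ^+ 2 - p t) * Y t) by near: t.
  have dVt : is_derive t 1 V (- (w ^+ 2 - dp t / 2 - p t ^+ 2 / 4) * Z t +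
    (w ^+ 4 - w ^+ 2 + dp t - p t * w ^+ 2 + p t ^+ 2 / 2) * Y t) by near: t.
  by apply: (is_derive_eq (derive_rotation w dZt dVt).2); rewrite /sg; field.
- near=> t; have dZt : is_derive t 1 Z (V t + (2 * w ^+ 2 - p t) * Y t) by near: t.
  have dVt : is_derive t 1 V (- (w ^+ 2 - dp t / 2 - p t ^+ 2 / 4) * Z t +
    (w ^+ 4 - w ^+ 2 + dp t - p t * w ^+ 2 + p t ^+ 2 / 2) * Y t) by near: t.
  by apply: (is_derive_eq (derive_opp (derive_rotation w dZt dVt).1)); rewrite /sg; field.
- exact: eventually_bounded_opp.
Unshelve. all: by end_near. Qed.

End Liouville.

(** * The equation *)

Section Equation.
Context {R : realType}.
Local Notation mu := (@lebesgue_measure R).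
Local Notation prim f := (fun t : R => Rintegral mu `[0, t] f).

(** Turns an extended-real finiteness condition into the real bound [M] used above. *)
Lemma primitive_bounded_of_integral_lty (g : R -> R) :
  continuous_ge0 g -> (forall t : R, 0 <= t -> 0 <= g t) ->
  (\int[mu]_(t in `[0%R, +oo[) (g t)%:E < +oo)%E ->
  forall t : R, prim g t <= fine (\int[mu]_(t in `[0%R, +oo[) (g t)%:E)%E.
Proof.
move=> cg g0 gfin t.
have gm := subspace_continuous_measurable_fun (measurable_itv `[0, +oo[) cg.
have pos (D : set R) : D `<=` `[0, +oo[ -> forall r, D r -> (0 <= (g r)%:E)%E.
  by move=> D0 r /D0 /=; rewrite in_itv/= andbT lee_fin; exact: g0.
have sub : [set` `[0, t]] `<=` [set` `[0, +oo[].
  by move=> r /=; rewrite !in_itv/= => /andP[-> _].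
have le : (\int[mu]_(s in `[0%R, t]) (g s)%:E <= \int[mu]_(s in `[0%R, +oo[) (g s)%:E)%E.
  apply: ge0_subset_integral => //; first exact/measurable_EFinP.
  exact: pos.
apply: fine_le => //.
  exact: (integrable_fin_num _ (@continuous_ge0_integrable _ g t cg)).
by rewrite ge0_fin_numE// integral_ge0//; exact: pos.
Qed.

Lemma cvg_integral_of_cvg_primitive (g : R -> R) : continuous_ge0 g ->
  cvg (prim g t @[t --> +oo]) ->
  exists l : R, (fun T : R => (\int[mu]_(t in `[0%R, T]) (g t)%:E)%E) @ +oo --> l%:E.
Proof.
move=> cg /cvg_ex[/= l gl]; exists l.
apply: cvg_EFin; last exact: gl.
apply: nearW => T; exact: (integrable_fin_num _ (@continuous_ge0_integrable _ g T cg)).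
Qed.

Lemma derive_Afun (p : R -> R) (t : R) : continuous_ge0 p -> 0 < t ->
  is_derive t 1 (Afun p) (2^-1 * p t * Afun p t).
Proof.
move=> cp t0; have dp := derive_mul (derive_const t 2^-1) (derive_primitive cp t0).
by apply: (is_derive_eq (derive_comp (is_derive_expR _) dp)); rewrite /Afun; ring.
Qed.

Lemma continuous_ge0_Afun (p : R -> R) : continuous_ge0 p -> continuous_ge0 (Afun p).
Proof.
move=> cp; apply: continuous_ge0_comp; first exact: continuous_expR.
apply: continuous_ge0_mul; first exact: continuous_ge0_cst.
exact/continuous_ge0_primitive/continuous_ge0_L1loc.
Qed.

(** Continuity of [v] comes first, as a primitive of an integrable function; only then is [x] the
    primitive of a continuous one. *)
Lemma continuous_ge0_solution (w : R) (p f x v : R -> R) : is_solution0 w p f x v ->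
  continuous_ge0 x /\ continuous_ge0 v.
Proof.
move=> [sI sE].
have cv : continuous_ge0 v.
  apply: (@continuous_ge0_eq _ (prim (fun s => f s - p s * v s - w ^+ 2 * x s))).
    by move=> t /sE[].
  exact: continuous_ge0_primitive.
split=> //; apply: (@continuous_ge0_eq _ (prim v)); first by move=> t /sE[].
exact/continuous_ge0_primitive/continuous_ge0_L1loc.
Qed.

Lemma derive_solution (w t : R) (p f x v : R -> R) : is_solution0 w p f x v -> 0 < t ->
  is_derive t 1 x (v t).
Proof.
move=> sol t0; have [_ cv] := continuous_ge0_solution sol.
have H := derive_primitive cv t0.
apply: near_eq_is_derive H; apply: near_gt0_eq => // s s0.
by have [-> _] := sol.2 s s0.
Qed.

(* [x'] and [y1] are merely absolutely continuous, but the nonsmooth part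
   [\int f] cancels in their difference. *)
Lemma derive_velocity_sub_y1 (w t : R) (p f x v : R -> R) : continuous_ge0 p ->
  L1loc f -> is_solution0 w p f x v -> 0 < t ->
  is_derive t 1 (fun t => v t - y1fun w f t)
    (w ^+ 2 * y1fun w f t - (p t * v t + w ^+ 2 * x t)).
Proof.
move=> cp fi sol t0; have [cx cv] := continuous_ge0_solution sol.
have ch : continuous_ge0 (fun s => p s * v s + w ^+ 2 * x s).
  apply: continuous_ge0_add; apply: continuous_ge0_mul => //.
  exact: continuous_ge0_cst.
(* The function is minus [y1 - \int f] minus the primitive of the continuous function [p v + w^2 x],
   and both parts are differentiable. *)
have H := derive_add (derive_opp (derive_y1_sub_primitive w fi t0))
  (derive_opp (derive_primitive ch t0)).
have e : - (- w ^+ 2 * y1fun w f t) + - (p t * v t + w ^+ 2 * x t) =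
  w ^+ 2 * y1fun w f t - (p t * v t + w ^+ 2 * x t) by ring.
apply: (is_derive_eq _ e).
apply: near_eq_is_derive H; apply: near_gt0_eq => // s s0.
have [_ ->] := sol.2 s s0.
have -> : prim (fun s => f s - p s * v s - w ^+ 2 * x s) s =
    prim (fun s => f s - (p s * v s + w ^+ 2 * x s)) s.
  by apply: eq_Rintegral => r _; rewrite opprD addrA.
rewrite RintegralB//; [ring|exact: fi|].
exact: (@continuous_ge0_integrable _ (fun s => p s * v s + w ^+ 2 * x s) s ch).
Qed.

End Equation.

(** * Verification of the transformed system for the given equation *)

Unset Implicit Arguments.
Set Strict Implicit.
Set Printing Implicit Defensive.

Theorem mainTheorem20 (R : realType) (w : R) (p dp f x v : R -> R) :
  0 < w ->
  (* p in C^1([0,oo)) with p' = dp *)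
  {within `[0, +oo[, continuous dp} ->
  (forall t, 0 <= t -> p t = p 0 + Rintegral (@lebesgue_measure R) `[0, t] dp) ->
  (forall t, 0 <= t -> 0 < p t) ->
  (forall t, 0 <= t -> dp t < 0) ->
  (\int[@lebesgue_measure R]_(t in `[0%R, +oo[) (p t)%:E = +oo)%E ->
  (\int[@lebesgue_measure R]_(t in `[0%R, +oo[) (p t ^+ 2)%:E < +oo)%E ->
  L1loc f ->
  (* x solves the equation with x(0) = x'(0) = 0, v = x' *)
  is_solution0 w p f x v ->
  (* p'(t) -> 0 *)
  dp @ +oo --> 0 ->
  (* y2 = o(1/A) *)
  littleo_pinfty (y2fun w f) (fun t => (Afun p t)^-1) ->
  (exists c1 c2 : R,
     littleo_pinfty
       (fun t => x t - (c1 * cos (w * t) + c2 * sin (w * t)) / Afun p t)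
       (fun t => (Afun p t)^-1)) ->
  (exists l : R,
     (fun T : R => (\int[@lebesgue_measure R]_(t in `[0%R, T])
                 (Afun p t * sin (w * t) * y2fun w f t)%:E)%E) @ +oo --> l%:E) /\
  (exists l : R,
     (fun T : R => (\int[@lebesgue_measure R]_(t in `[0%R, T])
                 (Afun p t * cos (w * t) * y2fun w f t)%:E)%E) @ +oo --> l%:E).
Proof.
move=> w0 cdp pE p_gt0 dp_lt0 _ p2fin fi sol dp0 y2o [c1 [c2 xo]].
have cp : continuous_ge0 p.
  apply: (@continuous_ge0_eq _ (fun t => p 0 + Rintegral lebesgue_measure `[0, t] dp)).
    by move=> t t0; rewrite [RHS]pE.
  apply: continuous_ge0_add; first exact: continuous_ge0_cst.
  exact/continuous_ge0_primitive/continuous_ge0_L1loc.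
have cA := continuous_ge0_Afun cp.
have cy1 : continuous_ge0 (y1fun w f) by exact: continuous_ge0_y1.
have cy2 : continuous_ge0 (y2fun w f).
  by rewrite y2fun_y1fun; apply/continuous_ge0_y1/continuous_ge0_L1loc.
have cp2 : continuous_ge0 (fun t => p t ^+ 2).
  by have := continuous_ge0_mul cp cp; under eq_fun do rewrite -expr2.
have A0 t : Afun p t != 0 by rewrite gt_eqF ?expR_gt0.
have dpt (t : R) : 0 < t -> is_derive t 1 p (dp t).
  move=> t0; have H := derive_add (derive_const t (p 0)) (derive_primitive cdp t0).
  rewrite add0r in H; apply: near_eq_is_derive H; apply: near_gt0_eq => // s s0.
  by rewrite [RHS]pE.
have cosc : continuous_ge0 (fun t => cos (w * t)).
  apply: continuous_ge0_everywhere => z; exact: is_derive_continuous (derive_cosM w z).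
have sinc : continuous_ge0 (fun t => sin (w * t)).
  apply: continuous_ge0_everywhere => z; exact: is_derive_continuous (derive_sinM w z).
pose Y t := Afun p t * y2fun w f t.
pose Z t := Afun p t * (x t - y2fun w f t).
(* This is [Z' - (2 w^2 - p) Y] written out; [v] and [y1] occur only through [v - y1], so [V] is
   differentiable although [f] is merely integrable. *)
pose V t := Afun p t * ((v t - y1fun w f t) + - ((w ^+ 2 - p t) * y2fun w f t))
  + 2^-1 * (p t * Z t).
have ccos : continuous_ge0 (fun t => Afun p t * cos (w * t) * y2fun w f t).
  by apply: continuous_ge0_mul => //; exact: continuous_ge0_mul.
have csin : continuous_ge0 (fun t => Afun p t * sin (w * t) * y2fun w f t).
  by apply: continuous_ge0_mul => //; exact: continuous_ge0_mul.
(* As [A] never vanishes, being [o(1/A)] means that the product with [A] tends to 0. *)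
have scaled_o g : littleo_pinfty g (fun t => (Afun p t)^-1) ->
    Afun p t * g t @[t --> +oo] --> (0:R).
  move=> go; apply/cvgrPdist_le => e e0; near=> t.
  rewrite sub0r normrN normrM mulrC -ler_pdivlMr ?normr_gt0// -normfV.
  by near: t; exact: go.
have Y0 : Y t @[t --> +oo] --> (0:R) by exact: scaled_o.
have dy2 (t : R) : 0 < t -> is_derive t 1 (y2fun w f) (y1fun w f t - w ^+ 2 * y2fun w f t).
  by move=> t0; rewrite y2fun_y1fun; exact: derive_y1_continuous.
have dZ (t : R) : 0 < t -> is_derive t 1 Z (V t + (2 * w ^+ 2 - p t) * Y t).
  move=> t0; apply: (is_derive_eq (derive_mul (derive_Afun cp t0)
    (derive_add (derive_solution sol t0) (derive_opp (dy2 t t0))))).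
  by rewrite /V /Z /Y; ring.
have dV (t : R) : 0 < t -> is_derive t 1 V
     (- (w ^+ 2 - dp t / 2 - p t ^+ 2 / 4) * Z t +
      (w ^+ 4 - w ^+ 2 + dp t - p t * w ^+ 2 + p t ^+ 2 / 2) * Y t).
  move=> t0; have dA := derive_Afun cp t0; have dq := dpt t t0.
  apply: (is_derive_eq (derive_add
    (derive_mul dA (derive_add (derive_velocity_sub_y1 cp fi sol t0)
      (derive_opp (derive_mul (derive_add (derive_const t (w ^+ 2)) (derive_opp dq))
        (dy2 t t0)))))
    (derive_mul (derive_const t 2^-1) (derive_mul dq (dZ t t0))))).
  by rewrite /V /Z /Y; field.
have [] := @cvg_oscillatory_integrals R w c1 c2
  (fine (\int[@lebesgue_measure R]_(t in `[0%R, +oo[) (p t ^+ 2)%:E)%E)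
  p dp (fun t => Rintegral lebesgue_measure `[0, t] (fun t => p t ^+ 2)) Z V Y
  (fun t => Rintegral lebesgue_measure `[0, t]
     (fun t => Afun p t * cos (w * t) * y2fun w f t))
  (fun t => Rintegral lebesgue_measure `[0, t]
     (fun t => Afun p t * sin (w * t) * y2fun w f t)) w0.
- near=> t; have t0 : 0 < t by near: t; exact: near_pinfty_gt.
  by split; [exact: dpt|apply: p_gt0; exact: ltW|apply: dp_lt0; exact: ltW].
- near=> t; have t0 : 0 < t by near: t; exact: near_pinfty_gt.
  exact: (derive_primitive cp2).
- near=> t; apply: primitive_bounded_of_integral_lty => // s _.
  exact: sqr_ge0.
- exact: dp0.
- exact: Y0.
(* [Z - tau] is [A] times the remainder in the expansion of [x], minus [Y]; both tend to 0. *)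
- have -> : (fun t => Z t - (c1 * cos (w * t) + c2 * sin (w * t))) = (fun t =>
      Afun p t * (x t - (c1 * cos (w * t) + c2 * sin (w * t)) / Afun p t) - Y t).
    by apply/funext => t; rewrite /Z /Y; field; rewrite A0.
  by have H := cvgB (scaled_o _ xo) Y0; rewrite subr0 in H; exact: H.
- near=> t; apply: dZ; near: t; exact: near_pinfty_gt.
- near=> t; apply: dV; near: t; exact: near_pinfty_gt.
- near=> t; have t0 : 0 < t by near: t; exact: near_pinfty_gt.
  by apply: (is_derive_eq (derive_primitive ccos t0)); rewrite /Y mulrAC.
- near=> t; have t0 : 0 < t by near: t; exact: near_pinfty_gt.
  by apply: (is_derive_eq (derive_primitive csin t0)); rewrite /Y mulrAC.
by split; exact: cvg_integral_of_cvg_primitive.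
Unshelve. all: by end_near. Qed.
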